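(* Let $\lambda\in\mathbb{R}$ and let $\mathcal{P}$ be a linear transformation of the split semi-quaternion algebra $\mathbb{H}_{ss}$, with matrix $P=(\gamma_0,\gamma_1,\gamma_2,\gamma_3)$ with respect to the basis $e_0,e_1,e_2,e_3$. Then $\mathcal{P}$ is a Rota-Baxter operator of weight $\lambda$ on $\mathbb{H}_{ss}$ if and only if $P$ and its column vectors $\gamma_i$ satisfy the following four matrix equations: $$\gamma_{0}(4)^{T}C^{T}P=P(E_{0},E_{1},E_{2},E_{3})\gamma_{0}(4)+P^{2}+\lambda P,$$ $$\gamma_{1}(4)^{T}C^{T}P=P(E_{0},E_{1},E_{2},E_{3})\gamma_{1}(4)+P\begin{pmatrix}0&1&0&0\\1&0&0&0\\0&0&0&-1\\0&0&-1&0\end{pmatrix}^{T}P+\lambda P\begin{pmatrix}0&1&0&0\\1&0&0&0\\0&0&0&-1\\0&0&-1&0\end{pmatrix}^{T},$$ $$\gamma_{2}(4)^{T}C^{T}P=P(E_{0},E_{1},E_{2},E_{3})\gamma_{2}(4)+P\begin{pmatrix}0&0&1&0\\0&0&0&1\\0&0&0&0\\0&0&0&0\end{pmatrix}^{T}P+\lambda P\begin{pmatrix}0&0&1&0\\0&0&0&1\\0&0&0&0\\0&0&0&0\end{pmatrix}^{T},$$ $$\gamma_{3}(4)^{T}C^{T}P=P(E_{0},E_{1},E_{2},E_{3})\gamma_{3}(4)+P\begin{pmatrix}0&0&0&1\\0&0&1&0\\0&0&0&0\\0&0&0&0\end{pmatrix}^{T}P+\lambda P\begin{pmatrix}0&0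&0&1\\0&0&1&0\\0&0&0&0\\0&0&0&0\end{pmatrix}^{T}.$$
   Context: All algebras are over $\mathbb{R}$ and linear means $\mathbb{R}$-linear. The split semi-quaternion algebra $\mathbb{H}_{ss}$ is the 4-dimensional associative unital $\mathbb{R}$-algebra with basis $e_0=1,e_1,e_2,e_3$ and multiplication $e_1^2=1$, $e_2^2=0$, $e_3^2=0$, $e_1e_2=e_3=-e_2e_1$, $e_2e_3=0=e_3e_2$, $e_3e_1=-e_2=-e_1e_3$. A Rota-Baxter operator of weight $\lambda\in\mathbb{R}$ on an algebra $A$ is a linear map $\mathcal{P}:A\to A$ with $\mathcal{P}(x)\mathcal{P}(y)=\mathcal{P}(\mathcal{P}(x)y)+\mathcal{P}(x\mathcal{P}(y))+\lambda\mathcal{P}(xy)$ for all $x,y\in A$. The matrix $P=(a_{ij})_{1\le i,j\le 4}=(\gamma_0,\gamma_1,\gamma_2,\gamma_3)$ of a linear transformation $\mathcal{P}$ has as columns the coordinate vectors $\gamma_i$ of $\mathcal{P}(e_i)$: $\mathcal{P}(e_i)=(e_0,e_1,e_2,e_3)\gamma_i$, $i=0,1,2,3$. $M^T$ is the transpose of $M$. For a matrix $M$, $M(4)$ is the block diagonal matrix with four diagonal blocks equal to $M$ (so $\gamma_j(4)$ is a $16\times 4$ matrix). $(E_0,E_1,E_2,E_3)$ denotes the $4\times16$ block row matrix formed from $$E_0=\begin{pmatrix}1&0&0&0\\0&1&0&0\\0&0&1&0\\0&0&0&1\end{pmatrix},\ E_1=\begin{pmatrix}0&1&0&0\\1&0&0&0\\0&0&0&1\\0&0&1&0\end{pmatrix},\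 E_2=\begin{pmatrix}0&0&0&0\\0&0&0&0\\1&0&0&0\\0&-1&0&0\end{pmatrix},\ E_3=\begin{pmatrix}0&0&0&0\\0&0&0&0\\0&-1&0&0\\1&0&0&0\end{pmatrix}.$$ $C$ is the $4\times 16$ matrix $C=(C_0,C_1,C_2,C_3)$ formed of the $4\times4$ blocks $$C_0=\begin{pmatrix}1&0&0&0\\0&1&0&0\\0&0&0&0\\0&0&0&0\end{pmatrix},\ C_1=\begin{pmatrix}0&1&0&0\\1&0&0&0\\0&0&0&0\\0&0&0&0\end{pmatrix},\ C_2=\begin{pmatrix}0&0&1&0\\0&0&0&1\\1&0&0&0\\0&-1&0&0\end{pmatrix},\ C_3=\begin{pmatrix}0&0&0&1\\0&0&1&0\\0&-1&0&0\\1&0&0&0\end{pmatrix}.$$ *)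

(* Defs.v *)
From HB Require Import structures.
From mathcomp Require Import all_boot all_order all_algebra.
From mathcomp Require Import all_reals.
From mathcomp Require Import ring.

Set Implicit Arguments.
Unset Strict Implicit.
Unset Printing Implicit Defensive.

Import GRing.Theory.
Local Open Scope ring_scope.

Definition rota_baxter (R : comNzRingType) (A : algType R) (lambda : R)
    (P : {linear A -> A}) : Prop :=
  forall x y : A,
    P x * P y = P (P x * y) + P (x * P y) + lambda *: P (x * y).

(* The split semi-quaternion algebra is carried by R^4; an element is the
   column of its coordinates in the basis e_0 = 1, e_1, e_2, e_3. *)
Definition Hss (R : comNzRingType) : Type := 'cV[R]_4.

HB.instance Definition _ (R : comNzRingType) :=
  GRing.Lmodule.copy (Hss R) 'cV[R]_4.

Definition hss_coord (R : comNzRingType) (x : Hss R) : 'cV[R]_4 := x.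

Definition hss_e (R : comNzRingType) (i : 'I_4) : Hss R := delta_mx i 0.

Lemma hss_coordP (R : comNzRingType) (x : Hss R) :
  x = \sum_i hss_coord x i 0 *: hss_e R i.
Proof.
rewrite {1}[x](matrix_sum_delta (x : 'cV_4)).
by apply: eq_bigr => i _; rewrite big_ord1.
Qed.

Definition hss_table (R : comNzRingType) (i j : 'I_4) : Hss R :=
  match nat_of_ord i, nat_of_ord j with
  | 0%N, _ => hss_e R j
  | _, 0%N => hss_e R i
  | 1%N, 1%N => hss_e R 0
  | 1%N, 2%N => hss_e R 3
  | 2%N, 1%N => - hss_e R 3
  | 3%N, 1%N => - hss_e R 2
  | 1%N, 3%N => hss_e R 2
  | _, _ => 0
  end.

Definition hss_mul (R : comNzRingType) (x y : Hss R) : Hss R :=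
  \sum_i \sum_j (hss_coord x i 0 * hss_coord y j 0) *: hss_table R i j.

Section HssRing.
Variable R : comNzRingType.
Implicit Types x y z : Hss R.

Let co x (k : nat) : R := hss_coord x (inord k) 0.

Lemma hss_mulE x y (k : 'I_4) :
  hss_coord (hss_mul x y) k 0 =
  match nat_of_ord k with
  | 0%N => co x 0 * co y 0 + co x 1 * co y 1
  | 1%N => co x 0 * co y 1 + co x 1 * co y 0
  | 2%N => co x 0 * co y 2 + co x 1 * co y 3 + co x 2 * co y 0 - co x 3 * co y 1
  | _ => co x 0 * co y 3 + co x 1 * co y 2 - co x 2 * co y 1 + co x 3 * co y 0
  end.
Proof.
have coE z (i : 'I_4) : hss_coord z i 0 = co z i by rewrite /co inord_val.
have -> : hss_coord (hss_mul x y) k 0 =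
    \sum_(i < 4) \sum_(j < 4) co x i * co y j * hss_coord (hss_table R i j) k 0.
  rewrite /hss_mul {1}/hss_coord summxE; apply: eq_bigr => i _.
  by rewrite summxE; apply: eq_bigr => j _; rewrite mxE !coE.
rewrite !big_ord_recl !big_ord0 /hss_table /= /bump /= /hss_coord /hss_e.
by case: k => [[|[|[|[|k]]]] hk] //=; rewrite !mxE /= -?val_eqE /=; ring.
Qed.

Let coM x y :
  (co (hss_mul x y) 0 = co x 0 * co y 0 + co x 1 * co y 1) *
  (co (hss_mul x y) 1 = co x 0 * co y 1 + co x 1 * co y 0) *
  (co (hss_mul x y) 2 =
     co x 0 * co y 2 + co x 1 * co y 3 + co x 2 * co y 0 - co x 3 * co y 1) *
  (co (hss_mul x y) 3 =
     co x 0 * co y 3 + co x 1 * co y 2 - co x 2 * co y 1 + co x 3 * co y 0).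
Proof. by do !split; rewrite {1}/co hss_mulE inordK. Qed.

Let coD x y k : co (x + y) k = co x k + co y k.
Proof. by rewrite /co /hss_coord mxE. Qed.

Let coZ a x k : co (a *: x) k = a * co x k.
Proof. by rewrite /co /hss_coord mxE. Qed.

Let co1 : (co (hss_e R 0) 0 = 1) * (co (hss_e R 0) 1 = 0) *
  (co (hss_e R 0) 2 = 0) * (co (hss_e R 0) 3 = 0).
Proof.
by do !split; rewrite /co /hss_coord /hss_e mxE -val_eqE /= inordK.
Qed.

Let co_inj x y : co x 0 = co y 0 -> co x 1 = co y 1 -> co x 2 = co y 2 ->
  co x 3 = co y 3 -> x = y.
Proof.
move=> h0 h1 h2 h3; apply/matrixP => i j; rewrite (ord1 j) -(inord_val i).
by case: i => [[|[|[|[|i]]]] hi].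
Qed.

Fact hss_mulA : associative (@hss_mul R).
Proof. by move=> x y z; apply: co_inj; rewrite !coM; ring. Qed.

Fact hss_mul1 : left_id (hss_e R 0) (@hss_mul R).
Proof. by move=> x; apply: co_inj; rewrite coM !co1; ring. Qed.

Fact hss_1mul : right_id (hss_e R 0) (@hss_mul R).
Proof. by move=> x; apply: co_inj; rewrite coM !co1; ring. Qed.

Fact hss_mulDl : left_distributive (@hss_mul R) +%R.
Proof. by move=> x y z; apply: co_inj; rewrite !(coM, coD); ring. Qed.

Fact hss_mulDr : right_distributive (@hss_mul R) +%R.
Proof. by move=> x y z; apply: co_inj; rewrite !(coM, coD); ring. Qed.

Fact hss_1neq0 : hss_e R 0 != 0.
Proof.
apply/eqP => /matrixP /(_ 0 0); rewrite !mxE /= => /eqP.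
by rewrite oner_eq0.
Qed.

Fact hss_scaleAl (a : R) x y : a *: hss_mul x y = hss_mul (a *: x) y.
Proof. by apply: co_inj; rewrite !(coM, coZ); ring. Qed.

Fact hss_scaleAr (a : R) x y : a *: hss_mul x y = hss_mul x (a *: y).
Proof. by apply: co_inj; rewrite !(coM, coZ); ring. Qed.

End HssRing.

HB.instance Definition _ (R : comNzRingType) :=
  GRing.Zmodule_isNzRing.Build (Hss R) (@hss_mulA R) (@hss_mul1 R)
    (@hss_1mul R) (@hss_mulDl R) (@hss_mulDr R) (hss_1neq0 R).
HB.instance Definition _ (R : comNzRingType) :=
  GRing.Lmodule_isLalgebra.Build R (Hss R) (@hss_scaleAl R).
HB.instance Definition _ (R : comNzRingType) :=
  GRing.Lalgebra_isAlgebra.Build R (Hss R) (@hss_scaleAr R).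

Lemma hss_eM (R : comNzRingType) (i j : 'I_4) :
  hss_e R i * hss_e R j = hss_table R i j.
Proof.
have -> : hss_e R i * hss_e R j = hss_mul (hss_e R i) (hss_e R j) by [].
rewrite /hss_mul (bigD1 i) //= (bigD1 j) //= /hss_coord !mxE !eqxx /= mulr1 scale1r.
rewrite !big1 ?addr0 // => [k /negPf ki|k /negPf kj].
  by apply: big1 => l _; rewrite mxE ki mul0r scale0r.
by rewrite !mxE kj mulr0 scale0r.
Qed.

Lemma hss_relations (R : comNzRingType) (e := hss_e R) :
  [/\ e 0 = 1, e 1 * e 1 = 1, e 2 * e 2 = 0 & e 3 * e 3 = 0] /\
  [/\ e 1 * e 2 = e 3, e 3 = - (e 2 * e 1), e 2 * e 3 = 0 & e 3 * e 2 = 0] /\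
  e 3 * e 1 = - e 2 /\ - e 2 = - (e 1 * e 3).
Proof. by rewrite /e !hss_eM /hss_table /= opprK. Qed.

(* Column j holds the coordinates of P (e_j). *)
Definition hss_mx (R : comNzRingType) (P : {linear Hss R -> Hss R}) :
    'M[R]_4 :=
  \matrix_(i, j) hss_coord (P (hss_e R j)) i 0.

Lemma hss_mxP (R : comNzRingType) (P : {linear Hss R -> Hss R}) 
    (j : 'I_4) :
  P (hss_e R j) = \sum_i (col j (hss_mx P)) i 0 *: hss_e R i.
Proof.
by rewrite {1}[LHS]hss_coordP; apply: eq_bigr => i _; rewrite !mxE.
Qed.

Definition row4 (R : Type) (m n : nat) (A0 A1 A2 A3 : 'M[R]_(m, n)) :
    'M[R]_(m, n + (n + (n + n))) :=
  row_mx A0 (row_mx A1 (row_mx A2 A3)).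

Definition diag4 (R : nzRingType) (m n : nat) (M : 'M[R]_(m, n)) :
    'M[R]_(m + (m + (m + m)), n + (n + (n + n))) :=
  block_mx M 0 0 (block_mx M 0 0 (block_mx M 0 0 M)).

Definition mx4 (R : nzRingType) (s : seq (seq R)) : 'M[R]_4 :=
  \matrix_(i, j) nth 0 (nth [::] s i) j.

(* hss_Ei is the matrix of left multiplication by e_i. *)
Definition hss_E0 (R : nzRingType) : 'M[R]_4 :=
  mx4 [:: [::  1;  0;  0;  0];
          [::  0;  1;  0;  0];
          [::  0;  0;  1;  0];
          [::  0;  0;  0;  1]].

Definition hss_E1 (R : nzRingType) : 'M[R]_4 :=
  mx4 [:: [::  0;  1;  0;  0];
          [::  1;  0;  0;  0];
          [::  0;  0;  0;  1];
          [::  0;  0;  1;  0]].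

Definition hss_E2 (R : nzRingType) : 'M[R]_4 :=
  mx4 [:: [::  0;  0;  0;  0];
          [::  0;  0;  0;  0];
          [::  1;  0;  0;  0];
          [::  0; -1;  0;  0]].

Definition hss_E3 (R : nzRingType) : 'M[R]_4 :=
  mx4 [:: [::  0;  0;  0;  0];
          [::  0;  0;  0;  0];
          [::  0; -1;  0;  0];
          [::  1;  0;  0;  0]].

(* hss_Ck is the Gram matrix of the bilinear form (x, y) |-> e_k-coordinate of
   x * y. *)
Definition hss_C0 (R : nzRingType) : 'M[R]_4 :=
  mx4 [:: [::  1;  0;  0;  0];
          [::  0;  1;  0;  0];
          [::  0;  0;  0;  0];
          [::  0;  0;  0;  0]].

Definition hss_C1 (R : nzRingType) : 'M[R]_4 :=
  mx4 [:: [::  0;  1;  0;  0];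
          [::  1;  0;  0;  0];
          [::  0;  0;  0;  0];
          [::  0;  0;  0;  0]].

Definition hss_C2 (R : nzRingType) : 'M[R]_4 :=
  mx4 [:: [::  0;  0;  1;  0];
          [::  0;  0;  0;  1];
          [::  1;  0;  0;  0];
          [::  0; -1;  0;  0]].

Definition hss_C3 (R : nzRingType) : 'M[R]_4 :=
  mx4 [:: [::  0;  0;  0;  1];
          [::  0;  0;  1;  0];
          [::  0; -1;  0;  0];
          [::  1;  0;  0;  0]].

(* The transpose of hss_Fj is the matrix of right multiplication by e_j. *)
Definition hss_F1 (R : nzRingType) : 'M[R]_4 :=
  mx4 [:: [::  0;  1;  0;  0];
          [::  1;  0;  0;  0];
          [::  0;  0;  0; -1];
          [::  0;  0; -1;  0]].

Definition hss_F2 (R : nzRingType) : 'M[R]_4 :=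
  mx4 [:: [::  0;  0;  1;  0];
          [::  0;  0;  0;  1];
          [::  0;  0;  0;  0];
          [::  0;  0;  0;  0]].

Definition hss_F3 (R : nzRingType) : 'M[R]_4 :=
  mx4 [:: [::  0;  0;  0;  1];
          [::  0;  0;  1;  0];
          [::  0;  0;  0;  0];
          [::  0;  0;  0;  0]].

Definition hss_E (R : nzRingType) : 'M[R]_(4, 16) :=
  row4 (hss_E0 R) (hss_E1 R) (hss_E2 R) (hss_E3 R).

Definition hss_C (R : nzRingType) : 'M[R]_(4, 16) :=
  row4 (hss_C0 R) (hss_C1 R) (hss_C2 R) (hss_C3 R).

(* Main.v *)
(** Writing N_y for the matrix of the right multiplication x |-> x * y, the
    matrices gamma_j(4)^T C^T and (E_0, E_1, E_2, E_3) gamma_j(4) are both equal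
    to N_y for y = P(e_j), and F_j^T is N_y for y = e_j (with F_0 = 1).  The j-th
    matrix equation is therefore the Rota-Baxter identity with second argument
    e_j, applied to all x at once; by linearity these four cases suffice. *)

Require Import Defs.
From mathcomp Require Import all_boot all_order all_algebra.
From mathcomp Require Import all_reals.
From mathcomp Require Import ring.
Import GRing.Theory.
Local Open Scope ring_scope.

Lemma hss_mx_mul (R : comNzRingType) (P : {linear Hss R -> Hss R})
    (x : Hss R) :
  P x = hss_mx P *m (x : 'cV_4).
Proof.
rewrite [in LHS](hss_coordP x) linear_sum /=; apply/colP => i.
rewrite summxE mxE; apply: eq_bigr => j _.
by rewrite linearZ /= !mxE mulrC.
Qed.

Definition hss_rmul_mx (R : comNzRingType) (y : Hss R) : 'M[R]_4 :=
  \matrix_(i, j) hss_coord (hss_e R j * y) i 0.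

Lemma hss_rmul_mxE (R : comNzRingType) (x y : Hss R) :
  hss_rmul_mx R y *m (x : 'cV_4) = x * y.
Proof.
rewrite [in RHS](hss_coordP x) mulr_suml; apply/colP => i.
rewrite summxE mxE; apply: eq_bigr => j _.
by rewrite -scalerAl !mxE mulrC.
Qed.

(** In the block product the [j]-th diagonal copy of [y] meets only the block [Aj]. Since [j < 4],
    the default [A0] of [nth] is never reached. *)
Lemma row4_mul_diag4 (R : nzRingType) (m n : nat)
    (A0 A1 A2 A3 : 'M[R]_(m, n)) (y : 'cV[R]_n) :
  row4 A0 A1 A2 A3 *m diag4 y =
  \matrix_(i < m, j < 4) (nth A0 [:: A0; A1; A2; A3] j *m y) i 0.
Proof.
rewrite /row4 /diag4 !mul_row_block !mulmx0 !addr0 !add0r.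
apply/matrixP => i j; rewrite [RHS]mxE.
(* The 4 columns are really [1 + (1 + (1 + 1))]; each split peels off one of them. *)
rewrite mxE; case: (@splitP 1 3 j) => [k ->|k ->]; first by rewrite (ord1 k).
rewrite mxE; case: (@splitP 1 2 k) => [l ->|l ->]; first by rewrite (ord1 l).
by rewrite mxE; case: (@splitP 1 1 l) => [p ->|p ->]; rewrite (ord1 p).
Qed.

(** Literal indices replace [inord], so that the entrywise comparisons with [mulmx_cV4E] below fall
    to [ring]. *)
Lemma hss_coordM (R : comNzRingType) (x y : Hss R) (k : 'I_4) :
  hss_coord (x * y) k 0 =
  match nat_of_ord k with
  | 0%N => x 0 0 * y 0 0 + x 1 0 * y 1 0
  | 1%N => x 0 0 * y 1 0 + x 1 0 * y 0 0
  | 2%N => x 0 0 * y 2 0 + x 1 0 * y 3 0 + x 2 0 * y 0 0 - x 3 0 * y 1 0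
  | _ => x 0 0 * y 3 0 + x 1 0 * y 2 0 - x 2 0 * y 1 0 + x 3 0 * y 0 0
  end.
Proof.
rewrite [LHS]hss_mulE /hss_coord.
have i0 : inord 0 = 0 :> 'I_4 by apply: val_inj; rewrite /= inordK.
have i1 : inord 1 = 1 :> 'I_4 by apply: val_inj; rewrite /= inordK.
have i2 : inord 2 = 2 :> 'I_4 by apply: val_inj; rewrite /= inordK.
have i3 : inord 3 = 3 :> 'I_4 by apply: val_inj; rewrite /= inordK.
by rewrite i0 i1 i2 i3.
Qed.

Lemma mulmx_cV4E (R : nzRingType) (m : nat) (A : 'M[R]_(m, 4))
    (y : 'cV[R]_4) (i : 'I_m) :
  (A *m y) i 0 = A i 0 * y 0 0 + A i 1 * y 1 0 + A i 2 * y 2 0 + A i 3 * y 3 0.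
Proof.
rewrite mxE !big_ord_recl big_ord0 addr0 !addrA.
by do !congr (_ + _); congr (A _ _ * y _ _); apply: val_inj.
Qed.

(** Column [j] on the left is [E_j y], the coordinates of [e_j * y]. *)
Lemma hss_E_diag4 (R : comNzRingType) (y : Hss R) :
  hss_E R *m diag4 (y : 'cV_4) = hss_rmul_mx R y.
Proof.
(* The ascription recasts the convertible width [4 + (4 + (4 + 4))] as 16, to match the goal. *)
rewrite (row4_mul_diag4 R 4 4 (hss_E0 R) (hss_E1 R) (hss_E2 R) (hss_E3 R) y
  : hss_E R *m _ = _).
apply/matrixP => i j.
rewrite [LHS]mxE [RHS]mxE mulmx_cV4E hss_coordM.
case: j i => [[|[|[|[|j]]]] hj] [[|[|[|[|i]]]] hi] //;
  rewrite !mxE /= -?val_eqE /=; ring.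
Qed.

(** Before transposing, entry [(k, i)] is [(C_i y)_k], the [e_i]-coordinate of [e_k * y], because
    [C_i] is a Gram matrix. *)
Lemma diag4T_hss_CT (R : comNzRingType) (y : Hss R) :
  (diag4 (y : 'cV_4))^T *m (hss_C R)^T = hss_rmul_mx R y.
Proof.
rewrite -trmx_mul.
rewrite (row4_mul_diag4 R 4 4 (hss_C0 R) (hss_C1 R) (hss_C2 R) (hss_C3 R) y
  : hss_C R *m _ = _).
apply/matrixP => i j.
rewrite 2![LHS]mxE [RHS]mxE mulmx_cV4E hss_coordM.
case: j i => [[|[|[|[|j]]]] hj] [[|[|[|[|i]]]] hi] //;
  rewrite !mxE /= -?val_eqE /=; ring.
Qed.

Lemma hss_rmul_mx_basis (R : comNzRingType) :
  [/\ hss_rmul_mx R (hss_e R 0) = 1%:M,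
      hss_rmul_mx R (hss_e R 1) = (hss_F1 R)^T,
      hss_rmul_mx R (hss_e R 2) = (hss_F2 R)^T &
      hss_rmul_mx R (hss_e R 3) = (hss_F3 R)^T].
Proof.
by split; apply/matrixP => i j; rewrite [LHS]mxE hss_eM;
  case: j i => [[|[|[|[|j]]]] hj] [[|[|[|[|i]]]] hi] //;
  rewrite /hss_coord !mxE /= -?val_eqE //= ?oppr0.
Qed.

(** For fixed [x], both sides of the identity are linear in the second argument. *)
Lemma rota_baxter_basisr (R : comNzRingType) (lambda : R)
    (P : {linear Hss R -> Hss R}) :
  rota_baxter lambda P <->
  forall (j : 'I_4) (x : Hss R) (y := hss_e R j),
    P x * P y = P (P x * y) + P (x * P y) + lambda *: P (x * y).
Proof.
split=> [h j x|h x y]; first exact: h.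
have PZ (a : R) (z : Hss R) : P (a *: z) = a *: P z by rewrite linearZ.
have hZ (a : R) (j : 'I_4) (z := a *: hss_e R j) :
    P x * P z = P (P x * z) + P (x * P z) + lambda *: P (x * z).
  rewrite /z PZ -!scalerAr !PZ h !scalerDr.
  by rewrite !scalerA [a * _]mulrC.
rewrite (hss_coordP y) linear_sum !mulr_sumr !linear_sum -!big_split.
by apply: eq_bigr => j _; exact: hZ.
Qed.

(** For a fixed second argument [e_j], each side is a matrix applied to [x]. Keeping [N] as a
    parameter lets the identity or [F_j^T] be substituted. *)
Lemma rota_baxter_mx (R : comNzRingType) (lambda : R)
    (P : {linear Hss R -> Hss R}) (j : 'I_4) (M := hss_mx P) (N : 'M_4) :
  hss_rmul_mx R (hss_e R j) = N ->
  (forall (x : Hss R) (y := hss_e R j),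
    P x * P y = P (P x * y) + P (x * P y) + lambda *: P (x * y)) <->
  (diag4 (col j M))^T *m (hss_C R)^T *m M =
    M *m hss_E R *m diag4 (col j M) + M *m N *m M + lambda *: M *m N.
Proof.
move=> <- {N}; have Pe : col j M = P (hss_e R j).
  by apply/colP => i; rewrite !mxE.
pose N := hss_rmul_mx R (hss_e R j); pose G := hss_rmul_mx R (P (hss_e R j)).
rewrite Pe diag4T_hss_CT -(mulmxA M) hss_E_diag4.
pose Q : 'M_4 := M *m G + M *m N *m M + lambda *: M *m N.
(* Restated so that the sizes read 4 instead of 1 + (1 + (1 + 1)). *)
suff: (forall x (y := hss_e R j),
  P x * P y = P (P x * y) + P (x * P y) + lambda *: P (x * y)) <->
  G *m M = Q by [].
have LE (x : Hss R) : P x * P (hss_e R j) = G *m M *m x.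
  by rewrite -hss_rmul_mxE [P x]hss_mx_mul mulmxA.
have QE (x : Hss R) : P (P x * hss_e R j) + P (x * P (hss_e R j)) +
    lambda *: P (x * hss_e R j) = Q *m x.
  (* The swap is needed because [Q] lists the term of [P (x * P e_j)] first, the identity that of
     [P (P x * e_j)]. *)
  rewrite /Q 2!mulmxDl -!scalemxAl [M *m G *m x + _]addrC.
  congr (_ + _ + lambda *: _); rewrite [LHS]hss_mx_mul -hss_rmul_mxE !mulmxA //.
  by rewrite [P x]hss_mx_mul !mulmxA.
split=> [h|h x y]; last by rewrite /y LE QE h.
have hx (x : Hss R) : G *m M *m x = Q *m x.
  exact: etrans (esym (LE x)) (etrans (h x) (QE x)).
(* Evaluating at [e_k] extracts the [k]-th columns. *)
apply/matrixP => i k; have /colP/(_ i) := hx (hss_e R k).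
by rewrite -!colE !mxE.
Qed.

Theorem theorem3p3 (R : realType) (lambda : R) (P : {linear Hss R -> Hss R}) :
  let M : 'M[R]_4 := hss_mx P in
  let gamma4 (j : 'I_4) : 'M[R]_(16, 4) := diag4 (col j M) in
  let E := hss_E R in
  let C := hss_C R in
  let F1 := hss_F1 R in
  let F2 := hss_F2 R in
  let F3 := hss_F3 R in
  rota_baxter lambda P <->
  [/\ (gamma4 0)^T *m C^T *m M =
        M *m E *m gamma4 0 + M ^+ 2 + lambda *: M,
      (gamma4 1)^T *m C^T *m M =
        M *m E *m gamma4 1 + M *m F1^T *m M + lambda *: M *m F1^T,
      (gamma4 2)^T *m C^T *m M =
        M *m E *m gamma4 2 + M *m F2^T *m M + lambda *: M *m F2^T &
      (gamma4 3)^T *m C^T *m M =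
        M *m E *m gamma4 3 + M *m F3^T *m M + lambda *: M *m F3^T].
Proof.
move=> M gamma4 E C F1 F2 F3; have [N0 N1 N2 N3] := hss_rmul_mx_basis R.
have := rota_baxter_mx R lambda P 0 _ N0; rewrite !mulmx1 => h0.
have h1 := rota_baxter_mx R lambda P 1 _ N1.
have h2 := rota_baxter_mx R lambda P 2 _ N2.
have h3 := rota_baxter_mx R lambda P 3 _ N3.
rewrite rota_baxter_basisr expr2; split=> [h|[/h0 k0 /h1 k1 /h2 k2 /h3 k3] j].
  by split; [apply/h0 | apply/h1 | apply/h2 | apply/h3]; apply: h.
(* With [isT] as its bound proof, [j] unifies with the literal index of the matching hypothesis. *)
by case: j => [[|[|[|[|j]]]] hj] x //; rewrite (bool_irrelevance hj isT); auto.
Qed.
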